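(* Let $G$ be a finite group, let $V$ be a finite-dimensional real inner product space with an orthogonal action of $G$, and let $V=\bigoplus_{i=1}^r V_i$ be an orthogonal decomposition into nonzero $G$-invariant subspaces such that no two distinct $V_i, V_j$ have isomorphic irreducible subrepresentations. Then the map $$(x_1,\dots,x_r)\longmapsto x=\sum_{i=1}^r \sqrt{\frac{\dim V_i}{\dim V}}\;x_i$$ is a bijection from the set of tuples $(x_1,\dots,x_r)$, where each $x_i\in V_i$ is a unit vector such that $Gx_i\subset S(V_i)$ is a spherical 2-design in $V_i$, onto the set of unit vectors $x\in S(V)$ such that $Gx\subset S(V)$ is a spherical 2-design in $V$. Conversely, each such $x$ determines the corresponding tuple by $$x_i=\frac{\pi_{V_i}(x)}{\|\pi_{V_i}(x)\|},\qquad\text{with}\quad \|\pi_{V_i}(x)\|^2=\frac{\dim V_i}{\dim V}.$$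
   Context: $S(V)$ is the unit sphere of $V$ and $\pi_{V_i}$ is orthogonal projection onto $V_i$. A finite set $X\subset S(V)$ is a spherical $t$-design if $\frac{1}{|X|}\sum_{x\in X} f(x)=\int_{S(V)} f\,d\mu$ for all real polynomial functions $f$ on $V$ of degree at most $t$, where $\mu$ is the normalized rotation-invariant measure on $S(V)$. For an orbit $Gv$ ($v$ a unit vector), being a 2-design amounts to $\sum_{g\in G} gv=0$ and $\frac{1}{|G|}\sum_{g\in G}(gv)(gv)^\top=\frac{1}{\dim V}I_V$. *)

(* Defs.v *)
From HB Require Import structures.
From mathcomp Require Import all_boot all_order all_fingroup all_algebra.
From mathcomp Require Import finmap.

Set Implicit Arguments.
Unset Strict Implicit.
Unset Printing Implicit Defensive.

(* The notations of [mpoly] clash with those of MathComp-Analysis, hence the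
   module. *)
Module PolynomialFunction.
From mathcomp Require Import mpoly.
Local Open Scope ring_scope.

(* [f] agrees on [W] with a polynomial of degree at most [t] in linear
   coordinates of [W]; its values outside [W] are irrelevant. *)
Definition polynomial_function (K : fieldType) (V : vectType K)
    (W : {vspace V}) (t : nat) (f : V -> K) : Prop :=
  exists2 p : {mpoly K[\dim W]}, (msize p <= t.+1)%N &
    {in W, forall v, f v = p.@[fun i => coord (vbasis W) i v]}.

End PolynomialFunction.
Notation polynomial_function := PolynomialFunction.polynomial_function.

From mathcomp Require Import all_classical all_reals all_analysis.

Import Order.TTheory GRing.Theory Num.Theory.
Local Open Scope classical_set_scope.
Local Open Scope ring_scope.

(* [borelV V] is [V] with its Borel sigma-algebra.  As [V] has finite
   dimension, this is the sigma-algebra generated by the preimages of Borel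
   sets of reals under linear functionals. *)
Definition linear_cylinder (R : realType) (V : vectType R) : set (set V) :=
  [set A | exists (phi : {scalar V}) (B : set R),
             measurable B /\ A = phi @^-1` B].

Definition pointedV (R : realType) (V : vectType R) : Type := V.
HB.instance Definition _ (R : realType) (V : vectType R) :=
  Choice.on (pointedV V).
HB.instance Definition _ (R : realType) (V : vectType R) :=
  isPointed.Build (pointedV V) (0 : V).

Definition borelV (R : realType) (V : vectType R) :=
  g_sigma_algebraType (@linear_cylinder R V : set (set (pointedV V))).

Section SphericalDesigns.
Variables (R : realType) (V : vectType R) (ip : {dot V for @idfun R}).
Implicit Types (U W : {vspace V}) (v : V) (X : {fset V}) (t : nat).

Definition ipnorm v : R := Num.sqrt (ip v v).

Definition sphere W : set V := [set v | v \in W /\ ipnorm v = 1].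

(* The measure on [sphere W] is seen as a measure on [V] carried by [sphere W].
   Invariance is under the full orthogonal group of [W] (for [\dim W = 1] the
   group SO(W) is trivial and would not determine the measure); only the
   restriction of [f] to [W] matters. *)
Definition is_sphere_measure W (mu : probability (borelV V) R) : Prop :=
  mu (sphere W) = 1%E /\
  forall f : 'End(V), (f @: W <= W)%VS ->
    {in W &, forall u v, ip (f u) (f v) = ip u v} ->
    forall A : set (borelV V), measurable A -> mu (f @^-1` A) = mu A.

(* A subset of the sphere of [W], tested against the measure [mu] of that
   sphere; the empty set is excluded by the constant polynomial 1. *)
Definition spherical_design W (mu : probability (borelV V) R) t X : Prop :=
  (forall x, x \in X -> sphere W x) /\
  forall f : V -> R, polynomial_function W t f ->
    (#|` X|%:R)^-1 * (\sum_(x <- X) f x) = \int[mu]_(x in sphere W) f x.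

Definition orthoproj W : 'End(V) := daddv_pi W (orthov ip W).

End SphericalDesigns.

Section Representations.
Variables (R : realType) (V : vectType R) (gT : finGroupType).
Variable rho : gT -> 'End(V).

Definition is_representation : Prop :=
  rho 1%g = \1%VF /\ forall g h : gT, rho (g * h)%g = (rho g \o rho h)%VF.

Definition orthogonal_action (ip : {dot V for @idfun R}) : Prop :=
  is_representation /\ forall g, isometry ip ip (rho g).

Definition invariant_subspace (U : {vspace V}) : Prop :=
  forall g, (rho g @: U <= U)%VS.

Definition irreducible_subrep (U : {vspace V}) : Prop :=
  [/\ U != 0%VS, invariant_subspace U &
      forall W : {vspace V}, (W <= U)%VS -> invariant_subspace W ->
        W = 0%VS \/ W = U].

Definition isomorphic_subreps (U W : {vspace V}) : Prop :=
  exists f : 'End(V),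
    [/\ (U :&: lker f)%VS = 0%VS, (f @: U)%VS = W &
        forall g, {in U, forall u, f (rho g u) = rho g (f u)}].

Definition rep_orbit (v : V) : {fset V} := [fset rho g v | g in {: gT}]%fset.

End Representations.

Definition weighted_sum (R : realType) (V : vectType R) (r : nat)
    (Vs : 'I_r -> {vspace V}) (x : 'I_r -> V) : V :=
  \sum_(i < r) Num.sqrt ((\dim (Vs i))%:R / (\dim {:V})%:R : R) *: x i.

(* Main.v *)
(* Invariance of the sphere measure under the reflections of [W] gives its
   moments: [ip u] has integral 0 and [ip u * ip w] has integral
   [ip u w / \dim W].  As these determine the integrals of all polynomials of
   degree at most 2, an orbit is a 2-design if and only if its first moments
   vanish and its second moments are [(\dim W)^-1 * ip u w]
   ([isotropic W (\dim W)^-1]).  For [x = \sum_i y i] with [y i] in [Vs i], the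
   mixed second moments between [y i] and [y j] are the entries of an
   intertwining operator from [Vs j] to [Vs i], hence vanish by Schur's lemma;
   so [x] is isotropic with constant [a] if and only if every [y i] is.  The
   trace of the second moments yields [ip (y i) (y i) = a * \dim (Vs i)]. *)
Require Import Defs.
From HB Require Import structures.
From mathcomp Require Import all_boot all_order all_fingroup all_algebra.
From mathcomp Require Import finmap.

Set Implicit Arguments.
Unset Strict Implicit.
Unset Printing Implicit Defensive.

(** * Polynomial functions of degree at most 2 *)

Module QuadraticPolynomial.
From mathcomp Require Import mpoly.
Import GRing.Theory.
Local Open Scope ring_scope.

(** Functions of the stated form are closed under sums and scalings and contain every monomial of
    degree at most 2, so induction along the support of [p] suffices. *)
Lemma meval_deg2 (K : comNzRingType) n (p : {mpoly K[n]}) :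
  (msize p <= 3)%N ->
  exists c b (a : 'I_n -> 'I_n -> K), forall x : 'I_n -> K,
    p.@[x] = c + \sum_i b i * x i + \sum_i \sum_j a i j * (x i * x j).
Proof.
move=> sp; pose Q (f : ('I_n -> K) -> K) :=
  exists c b (a : 'I_n -> 'I_n -> K), forall x,
    f x = c + \sum_i b i * x i + \sum_i \sum_j a i j * (x i * x j).
have Qeq f g : f =1 g -> Q g -> Q f.
  by move=> fg [c [b [a h]]]; exists c, b, a => x; rewrite fg.
have Q0 : Q (fun=> 0).
  exists 0, (fun=> 0), (fun _ _ => 0) => x.
  by rewrite !big1 ?addr0// => i _; [rewrite big1// => j _|]; rewrite mul0r.
have QD f g : Q f -> Q g -> Q (fun x => f x + g x).
  move=> [c [b [a h]]] [c' [b' [a' h']]].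
  exists (c + c'), (fun i => b i + b' i), (fun i j => a i j + a' i j) => x.
  rewrite h h'.
  under [in RHS]eq_bigr do rewrite mulrDl.
  under [X in _ = _ + X]eq_bigr do
    (under eq_bigr do rewrite mulrDl; rewrite big_split/=).
  by rewrite !big_split/= addrACA (addrACA c).
have QZ k f : Q f -> Q (fun x => k * f x).
  move=> [c [b [a h]]].
  exists (k * c), (fun i => k * b i), (fun i j => k * a i j) => x.
  rewrite h !mulrDr !mulr_sumr; congr (_ + _ + _).
    by apply: eq_bigr => i _; rewrite mulrA.
  by apply: eq_bigr => i _; rewrite mulr_sumr; apply: eq_bigr => j _; rewrite mulrA.
have Qc k : Q (fun=> k).
  exists k, (fun=> 0), (fun _ _ => 0) => x.
  by rewrite !big1 ?addr0// => i _; [rewrite big1// => j _|]; rewrite mul0r.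
have QX i : Q (fun x => x i).
  exists 0, (fun k => (k == i)%:R), (fun _ _ => 0) => x.
  rewrite add0r [X in _ + X]big1 ?addr0; last first.
    by move=> k _; rewrite big1// => j _; rewrite mul0r.
  by rewrite (bigD1 i)//= eqxx mul1r big1 ?addr0// => k /negPf->; rewrite mul0r.
have QXX i j : Q (fun x => x i * x j).
  exists 0, (fun=> 0), (fun k l => (k == i)%:R * (l == j)%:R) => x.
  rewrite add0r [X in X + _]big1 ?add0r; last by move=> k _; rewrite mul0r.
  rewrite (bigD1 i)//= eqxx [X in _ + X]big1 ?addr0; last first.
    by move=> k /negPf->; rewrite big1// => l _; rewrite mul0r mul0r.
  rewrite (bigD1 j)//= eqxx !mul1r big1 ?addr0// => l /negPf->.
  by rewrite mulr0 mul0r.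
have QM m : (mdeg m < 3)%N -> Q (fun x => 'X_[K, m].@[x]).
  rewrite ltnS leq_eqVlt ltnS leq_eqVlt ltnS leqn0 => /or3P[/eqP m2|/mdeg1P[i /eqP ->]|].
  (* Degree 2: some [i] occurs in [m], and removing it leaves a monomial of degree 1, hence a single
     variable [j]. *)
  - have [i mi] : exists i, (0 < m i)%N.
      have : (0 < \sum_i m i)%N by rewrite -mdegE m2.
      by rewrite lt0n sum_nat_eq0 => /forallPn[i]; rewrite /= -lt0n; exists i.
    have im : (U_(i) <= m)%MM.
      by apply/mnm_lepP => j; rewrite mnm1E; case: eqP => // <-.
    have mE := submK im.
    have /mdeg1P[j /eqP jE] : (mdeg (m - U_(i))%MM == 1)%N.
      by have := mdegD (m - U_(i)) U_(i); rewrite mE m2 mdeg1 addn1 => -[<-].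
    rewrite -mE jE. apply: (Qeq _ _ _ (QXX j i)) => x.
    by rewrite mpolyXD mevalM !mevalXU.
  - by apply: (Qeq _ _ _ (QX i)) => x; rewrite mevalXU.
  - by rewrite mdeg_eq0 => /eqP->; apply: (Qeq _ _ _ (Qc 1)) => x; rewrite mpolyX0 meval1.
have : all (fun m => mdeg m < 3)%N (msupp p).
  by apply/allP => m /msize_mdeg_lt h; apply: leq_trans h sp.
suff QS s : all (fun m => mdeg m < 3)%N s ->
    Q (fun x => \sum_(m <- s) p@_m * 'X_[K, m].@[x]).
  move/QS; apply: Qeq => x; rewrite mevalE.
  by apply: eq_bigr => m _; rewrite mevalX.
elim: s => [|m s IH] /=; first by move=> _; apply: (Qeq _ _ _ Q0) => x; rewrite big_nil.
by case/andP=> /QM/(QZ p@_m) hm /IH/(QD _ _ hm); apply: Qeq => x; rewrite big_cons.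
Qed.

Lemma polynomial_function_coord (K : fieldType) (V : vectType K)
    (W : {vspace V}) f : polynomial_function W 2 f ->
  exists c b (a : 'I_(\dim W) -> 'I_(\dim W) -> K), {in W, forall v,
    f v = c + \sum_i b i * coord (vbasis W) i v
      + \sum_i \sum_j a i j * (coord (vbasis W) i v * coord (vbasis W) j v)}.
Proof.
case=> p /meval_deg2[c [b [a pE]]] fE; exists c, b, a => v /fE ->.
exact: pE.
Qed.

Section LinearFunctionals.
Variables (K : fieldType) (V : vectType K) (W : {vspace V}).
Implicit Types phi psi : {scalar V}.

Let lin phi : {mpoly K[\dim W]} :=
  \sum_(i < \dim W) phi (vbasis W)`_i *: 'X_i.

Let msize_lin phi : (msize (lin phi) <= 2)%N.
Proof.
rewrite /lin; elim/big_ind: _ => [|p q sp sq|i _]; first by rewrite msize0.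
  by rewrite (leq_trans (msizeD_le _ _))// geq_max sp.
by rewrite (leq_trans (msizeZ_le _ _))// msizeX mdeg1.
Qed.

Let lin_eval phi v : v \in W ->
  phi v = (lin phi).@[fun i => coord (vbasis W) i v].
Proof.
move=> vW; rewrite {1}(coord_vbasis vW) linear_sum raddf_sum.
by apply: eq_bigr => i _; rewrite linearZ /= mevalZ mevalXU mulrC.
Qed.

(** This and the next lemma supply the test functions that read off the first and second moments of
    a design. *)
Lemma polynomial_function_linear phi : polynomial_function W 2 phi.
Proof.
by exists (lin phi); [exact: leqW (msize_lin _) | exact: lin_eval].
Qed.

Lemma polynomial_function_linearM phi psi :
  polynomial_function W 2 (fun v => phi v * psi v).
Proof.
exists (lin phi * lin psi) => [|v vW]; last by rewrite mevalM -!lin_eval.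
have [->|p0] := eqVneq (lin phi) 0; first by rewrite mul0r msize0.
have [->|q0] := eqVneq (lin psi) 0; first by rewrite mulr0 msize0.
rewrite msizeM// -subn1 leq_subLR.
exact: leq_add (msize_lin phi) (msize_lin psi).
Qed.

End LinearFunctionals.
End QuadraticPolynomial.

From mathcomp Require Import all_classical all_reals all_analysis.
From mathcomp Require Import measurable_realfun.
From mathcomp Require Import ring lra.

Import Order.TTheory GRing.Theory Num.Theory.
Local Open Scope classical_set_scope.
Local Open Scope ring_scope.

(** * Inner products, orthonormal expansion and reflections *)

Section Reflection.
Variables (R : realType) (V : vectType R) (ip : {dot V for @idfun R}).
Implicit Types (u v w : V) (W : {vspace V}).

Lemma ipC u v : ip u v = ip v u.
Proof. by rewrite hermC expr0 mul1r. Qed.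

Lemma ipDl u v w : ip (u + v) w = ip u w + ip v w.
Proof. exact: linearDl. Qed.

Lemma ipDr u v w : ip w (u + v) = ip w u + ip w v.
Proof. exact: linearD. Qed.

Lemma ipBl u v w : ip (u - v) w = ip u w - ip v w.
Proof. exact: linearBl. Qed.

Lemma ipBr u v w : ip w (u - v) = ip w u - ip w v.
Proof. exact: linearB. Qed.

Lemma ipZl a u w : ip (a *: u) w = a * ip u w.
Proof. exact: linearZl_LR. Qed.

Lemma ipZr a u w : ip w (a *: u) = a * ip w u.
Proof. by rewrite ipC ipZl ipC. Qed.

Lemma ip_suml I (s : seq I) (F : I -> V) w :
  ip (\sum_(i <- s) F i) w = \sum_(i <- s) ip (F i) w.
Proof. by rewrite ipC linear_sum; apply: eq_bigr => i _; rewrite ipC. Qed.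

Lemma ip_sumr I (s : seq I) (F : I -> V) w :
  ip w (\sum_(i <- s) F i) = \sum_(i <- s) ip w (F i).
Proof. exact: linear_sum. Qed.

Lemma ip_gt0 u : u != 0 -> 0 < ip u u.
Proof. exact: neq0_dnorm_gt0. Qed.

Lemma ip_eq0 u : (ip u u == 0) = (u == 0).
Proof.
have [->|/ip_gt0/gt_eqF//] := eqVneq u 0.
by rewrite linear0r eqxx.
Qed.

Lemma ip_ge0 u : 0 <= ip u u.
Proof.
by have [->|/ip_gt0/ltW//] := eqVneq u 0; rewrite linear0r.
Qed.

Lemma ipnorm_sqr u : ipnorm ip u ^+ 2 = ip u u.
Proof. by rewrite sqr_sqrtr// ip_ge0. Qed.

Lemma ipnorm1 u : (ipnorm ip u = 1) <-> (ip u u = 1).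
Proof.
split=> [u1|u1]; first by rewrite -ipnorm_sqr u1 expr1n.
by rewrite /ipnorm u1 sqrtr1.
Qed.

(** A crude form of Cauchy-Schwarz, from the squared norms of [u + v] and [u - v] being nonnegative;
    it is enough to bound integrands on the sphere. *)
Lemma ip_le u v : `|ip u v| <= ip u u + ip v v.
Proof.
rewrite ler_norml; apply/andP; split.
  have := ip_ge0 (u + v); rewrite hnormD/= expr0 mul1r.
  have := ip_ge0 u; have := ip_ge0 v; rewrite /=; lra.
have := ip_ge0 (u - v); rewrite hnormB/= expr0 mul1r.
have := ip_ge0 u; have := ip_ge0 v; rewrite /=; lra.
Qed.

Lemma mem_orthov_line u v : (u \in orthov ip <[v]>) = (ip u v == 0).
Proof. exact: mem_orthov1. Qed.

(* Orthogonality of the frame is never needed: expansion and unit norms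
   give the Riesz representation, Parseval and traces. *)
Lemma unit_frame W : exists s : seq V,
  [/\ size s = \dim W, {subset s <= W}, {in s, forall e, ip e e = 1} &
      {in W, forall v, v = \sum_(e <- s) ip v e *: e}].
Proof.
have [n] := ubnP (\dim W); elim: n W => // n IH W dW.
have [W0|W0] := eqVneq W 0%VS.
  exists [::]; split=> //; first by rewrite W0 dimv0.
  by move=> v; rewrite W0 memv0 big_nil => /eqP.
pose u := vpick W; have uW : u \in W := memv_pick W.
have u0 : u != 0 by rewrite vpick0.
pose e := (Num.sqrt (ip u u))^-1 *: u.
have eW : e \in W by rewrite memvZ.
have e1 : ip e e = 1.
  rewrite ipZl ipZr mulrA -expr2 exprVn sqr_sqrtr ?ip_ge0// mulVf//.
  by rewrite ip_eq0.
have e0 : ip e e != 0 by rewrite e1 oner_eq0.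
(* Since [e] is in [W] and not orthogonal to it, intersecting [W] with the complement of [e] lowers
   the dimension by exactly one. *)
have eN : e \notin orthov ip W.
  by apply/mem_orthovPn; exists e.
have dE := eq_dim_orthov1 eN.
have d0 : (0 < \dim W)%N by rewrite lt0n dimv_eq0.
case: (IH (W :&: orthov ip <[e]>)%VS); first by rewrite -dE prednK.
move=> s [sz sW s1 sE]; exists (e :: s); split.
- by rewrite /= sz -dE prednK.
- move=> f; rewrite inE => /predU1P[->//|/sW]; first by rewrite memv_cap => /andP[].
- by move=> f; rewrite inE => /predU1P[->//|/s1].
move=> v vW; rewrite big_cons.
have se f : f \in s -> ip e f = 0.
  move=> /sW; rewrite memv_cap => /andP[_].
  by rewrite mem_orthov_line ipC => /eqP.
have : v - ip v e *: e \in (W :&: orthov ip <[e]>)%VS.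
  rewrite memv_cap memvB ?memvZ//= mem_orthov_line.
  rewrite ipBl ipZl. by rewrite e1 mulr1 subrr.
move/sE/eqP; rewrite subr_eq addrC => /eqP {1}->; congr (_ + _).
rewrite !big_seq; apply: eq_bigr => f /se ef.
by rewrite ipBl ipZl ef mulr0 subr0.
Qed.

Lemma riesz W (phi : {scalar V}) :
  exists2 u, u \in W & {in W, forall v, phi v = ip u v}.
Proof.
have [s [_ sW _ sE]] := unit_frame W.
exists (\sum_(e <- s) phi e *: e).
  by rewrite big_seq memv_suml// => e /sW eW; rewrite memvZ.
move=> v vW; rewrite {1}(sE v vW) linear_sum ip_suml.
by apply: eq_bigr => e _; rewrite linearZ ipZl ipC mulrC.
Qed.

(** For [u = 0] the quotient has the default value 0 and the map is the identity, so linearity and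
    isometry hold for every [u]. *)
Definition reflection_fun u v := v - (2 * ip u v / ip u u) *: u.

Fact reflection_fun_linear u : linear (reflection_fun u).
Proof.
move=> a v w; rewrite /reflection_fun ipDr ipZr.
have -> : 2 * (a * ip u v + ip u w) / ip u u =
  a * (2 * ip u v / ip u u) + 2 * ip u w / ip u u by ring.
by rewrite scalerDl opprD addrACA scalerBr scalerA.
Qed.

HB.instance Definition _ u :=
  GRing.isLinear.Build R V V _ (reflection_fun u) (reflection_fun_linear u).

Definition reflection u : 'End(V) := linfun (reflection_fun u).

Lemma reflectionE u v : reflection u v = v - (2 * ip u v / ip u u) *: u.
Proof. by rewrite lfunE. Qed.

Lemma reflection_isometry u v w :
  ip (reflection u v) (reflection u w) = ip v w.
Proof.
rewrite !reflectionE.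
have [->|u0] := eqVneq u 0; first by rewrite !scaler0 !subr0.
have h := ip_gt0 u0.
rewrite !(ipBl, ipBr) !ipZl !ipZr (ipC v u).
by field; rewrite gt_eqF.
Qed.

Lemma reflection_id u v : ip u v = 0 -> reflection u v = v.
Proof. by move=> uv; rewrite reflectionE uv mulr0 mul0r scale0r subr0. Qed.

Lemma reflection_self u : reflection u u = - u.
Proof.
have [->|u0] := eqVneq u 0; first by rewrite linear0 oppr0.
rewrite reflectionE mulfK ?ip_eq0// scaler_nat mulr2n opprD addrA subrr.
by rewrite add0r.
Qed.

(** Equal norms give [ip (u - w) (u - w) = 2 * ip (u - w) u], so the coefficient in the reflection
    formula is 1. *)
Lemma reflection_swap u w : ip u u = ip w w -> reflection (u - w) u = w.
Proof.
move=> uw; have [->|uw0] := eqVneq u w.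
  by rewrite subrr reflectionE scaler0 subr0.
have d0 : ip (u - w) (u - w) != 0 by rewrite ip_eq0 subr_eq0.
have dE : ip (u - w) (u - w) = 2 * ip (u - w) u.
  by rewrite !(ipBl, ipBr) -uw (ipC w u); ring.
by rewrite reflectionE -dE divff// scale1r opprB addrC subrK.
Qed.

Lemma reflection_inv u : involutive (reflection u).
Proof.
move=> v; rewrite [X in reflection u X]reflectionE linearB linearZ/= reflection_self reflectionE.
by rewrite scalerN opprK subrK.
Qed.

Lemma reflection_adjoint x u v :
  ip u (reflection x v) = ip (reflection x u) v.
Proof. by rewrite -[RHS](reflection_isometry x) reflection_inv. Qed.

Lemma reflection_mem u W v : u \in W -> (reflection u v \in W) = (v \in W).
Proof.
move=> uW; rewrite reflectionE.
apply/idP/idP => h; last by rewrite memvB ?memvZ.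
by rewrite -(subrK ((2 * ip u v / ip u u) *: u) v) memvD ?memvZ.
Qed.

Lemma orthov_cap0 W : (W :&: orthov ip W = 0)%VS.
Proof.
apply/eqP; rewrite -subv0; apply/subvP => v.
rewrite memv_cap memv0 => /andP[vW /mem_orthovP/(_ v vW)/eqP].
by rewrite ip_eq0.
Qed.

Lemma orthoprojE W v w : v \in W -> w \in orthov ip W ->
  orthoproj ip W (v + w) = v.
Proof.
move=> vW wW; rewrite /orthoproj.
have h := @daddv_pi_add _ _ W (orthov ip W) (v + w) (orthov_cap0 W).
have vwW := memv_add vW wW; have {}h := h vwW.
rewrite linearD/= daddv_pi_id ?orthov_cap0//.
(* The projection along the other summand fixes [w], and the two projections of [w] add up to
   [w]. *)
suff -> : daddv_pi W (orthov ip W) w = 0 by rewrite addr0.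
have := daddv_pi_add (orthov_cap0 W) (subvP (addvSr W (orthov ip W)) _ wW).
rewrite [X in _ + X]daddv_pi_id//; last by rewrite capvC orthov_cap0.
by move/eqP; rewrite -subr_eq0 addrK => /eqP.
Qed.

End Reflection.

(** * Measurability and the first two moments of the sphere measure *)

Section SphereMeasure.
Variables (R : realType) (V : vectType R) (ip : {dot V for @idfun R}).
Implicit Types (u v w : V) (W : {vspace V}).

Lemma measurable_scalar (phi : {scalar V}) :
  measurable_fun setT (phi : borelV V -> R).
Proof. by move=> _ B mB; rewrite setTI; apply: sub_sigma_algebra; exists phi, B. Qed.

Lemma measurable_ip u : measurable_fun setT (ip u : borelV V -> R).
Proof. exact: (measurable_scalar (ip u)). Qed.

(** It suffices to test generators, and the preimage under [f] of a cylinder over [phi] is a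
    cylinder over [phi \o f]. *)
Lemma measurable_end (f : 'End(V)) :
  measurable_fun setT (f : borelV V -> borelV V).
Proof.
apply: (@measurability _ _ (borelV V) (borelV V) setT f
  (@linear_cylinder R V) erefl) => _ [_ [phi [B [mB ->]]] <-].
rewrite setTI; apply: sub_sigma_algebra.
by exists (phi \o f), B.
Qed.

(** By Parseval the squared norm is a finite sum of squares of linear functionals. *)
Lemma measurable_sqnorm_end (f : 'End(V)) :
  measurable_fun setT (fun v : borelV V => ip (f v) (f v)).
Proof.
have [s [_ _ _ sE]] := unit_frame ip fullv.
rewrite (_ : (fun _ => _) = fun v => \sum_(e <- s) ip e (f v) * ip e (f v)).
  apply: measurable_sum => e; have := @measurable_scalar (ip e \o f).
  by move=> me; exact: measurable_funM.
apply/funext => v; rewrite [in X in ip X _](sE (f v) (memvf _)) ip_suml.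
by apply: eq_bigr => e _; rewrite ipZl (ipC _ _ e).
Qed.

Lemma measurable_sphere W : measurable (sphere ip W : set (borelV V)).
Proof.
(* The kernel of [f] is [W], which turns membership in [W] into the measurable condition that a
   squared norm vanishes. *)
pose f := (\1 - projv W)%VF.
rewrite (_ : sphere _ _ =
    [set v | ip (f v) (f v) = 0] `&` [set v | ip (\1%VF v) (\1%VF v) = 1]).
  apply: measurableI.
    by rewrite -[X in measurable X]setTI; 
    exact: (measurable_sqnorm_end f measurableT (measurable_set1 0)).
  by rewrite -[X in measurable X]setTI; 
  exact: (measurable_sqnorm_end \1 measurableT (measurable_set1 1)).
apply/seteqP; split => v /= [vW v1]; rewrite /sphere /=.
  rewrite id_lfunE; split; last by apply/ipnorm1.
  by rewrite add_lfunE opp_lfunE id_lfunE projv_id// subrr linear0r.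
move: v1; rewrite id_lfunE => /ipnorm1 v1; split=> //.
move/eqP: vW; rewrite ip_eq0 add_lfunE opp_lfunE id_lfunE subr_eq0 => /eqP ->.
exact: memv_proj.
Qed.

Variables (W : {vspace V}) (mu : probability (borelV V) R).
Hypothesis mu_sphere : is_sphere_measure ip W mu.
Local Notation S := (sphere ip W).

(** The sphere of the zero subspace is empty and cannot have measure 1. *)
Lemma sphere_dim_gt0 : (0 < \dim W)%N.
Proof.
rewrite lt0n dimv_eq0; apply/eqP => W0.
have := proj1 mu_sphere; rewrite (_ : S = set0) ?measure0.
  by move=> /eqP; rewrite eq_sym onee_eq0.
apply/seteqP; split => // v [].
by rewrite W0 memv0 => /eqP -> /ipnorm1/eqP; rewrite linear0r eq_sym oner_eq0.
Qed.

Lemma sphere_integrable (h : V -> R) (M : R) :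
  measurable_fun setT (h : borelV V -> R) -> (forall v, S v -> `|h v| <= M) ->
  mu.-integrable S (EFin \o h).
Proof.
move=> mh hM; apply: measurable_bounded_integrable.
- exact: measurable_sphere.
- apply: le_lt_trans (ltry 1); apply: probability_le1; exact: measurable_sphere.
- exact: measurable_funTS.
- exists M; split; first exact: num_real.
  by move=> N MN v /hM /le_trans; apply; exact: ltW.
Qed.

Lemma sphere_ip_le u v : S v -> `|ip u v| <= ip u u + 1.
Proof. by case=> _ /ipnorm1 v1; rewrite -v1 ip_le. Qed.

Lemma sphere_integrable_ip u : mu.-integrable S (EFin \o ip u).
Proof.
apply: sphere_integrable (measurable_ip u) _ => v; exact: sphere_ip_le.
Qed.

Lemma sphere_integrable_ipM u w :
  mu.-integrable S (EFin \o (fun v => ip u v * ip w v)).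
Proof.
apply: (@sphere_integrable _ ((ip u u + 1) * (ip w w + 1))).
  by apply: measurable_funM; exact: measurable_ip.
by move=> v Sv; rewrite normrM ler_pM// sphere_ip_le.
Qed.

Lemma sphere_integrable_cst (c : R) : mu.-integrable S (EFin \o cst c).
Proof. exact: (@sphere_integrable _ `|c|). Qed.

Lemma sphere_integrableD (f g : V -> R) :
  mu.-integrable S (EFin \o f) -> mu.-integrable S (EFin \o g) ->
  mu.-integrable S (EFin \o (fun v => f v + g v)).
Proof. by move=> fi gi; exact: (integrableD (measurable_sphere W) fi gi). Qed.

Lemma sphere_integrableZl c (f : V -> R) :
  mu.-integrable S (EFin \o f) ->
  mu.-integrable S (EFin \o (fun v => c * f v)).
Proof. by move=> fi; exact: (integrableZl (measurable_sphere W) c fi). Qed.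

Lemma sphere_integrable_sum I (s : seq I) (F : I -> V -> R) :
  (forall i, mu.-integrable S (EFin \o F i)) ->
  mu.-integrable S (EFin \o (fun v => \sum_(i <- s) F i v)).
Proof.
move=> iF; elim: s => [|i s IH].
  by under eq_fun do rewrite big_nil; exact: sphere_integrable_cst.
by under eq_fun do rewrite big_cons; exact: sphere_integrableD.
Qed.

Lemma sphere_integral_sum I (s : seq I) (F : I -> V -> R) :
  (forall i, mu.-integrable S (EFin \o F i)) ->
  \int[mu]_(v in S) (\sum_(i <- s) F i v) =
  \sum_(i <- s) \int[mu]_(v in S) F i v.
Proof.
move=> iF; elim: s => [|i s IH].
  (* For the empty sum, the 0 on the right is written as an integral over the empty set. *)
  rewrite big_nil -[RHS](Rintegral_set0 mu (cst 0)) /Rintegral; congr fine.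
  by rewrite integral_set0 integral0_eq// => v _; rewrite big_nil.
rewrite big_cons -IH; under eq_Rintegral do rewrite big_cons.
by rewrite RintegralD//; [exact: measurable_sphere|exact: sphere_integrable_sum].
Qed.

Lemma sphere_integral_cst (c : R) : \int[mu]_(v in S) c = c.
Proof.
rewrite Rintegral_cst; last exact: measurable_sphere.
by rewrite [X in fine X](proj1 mu_sphere) mulr1.
Qed.

(** A reflection in a vector of [W] is an isometry preserving [W], so its pushforward of [mu] is
    [mu] and the sphere is its own preimage; the rest is change of variables. *)
Lemma sphere_reflection_invariant u (h : V -> R) : u \in W ->
  measurable_fun setT (h : borelV V -> R) ->
  mu.-integrable S (EFin \o (h \o reflection ip u)) ->
  \int[mu]_(v in S) h (reflection ip u v) = \int[mu]_(v in S) h v.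
Proof.
move=> uW mh ihr; set f := reflection ip u.
have fS : (f : V -> V) @^-1` S = S.
  apply/seteqP; split => v /=.
    by case; rewrite reflection_mem// => vW; rewrite /ipnorm reflection_isometry.
  by case=> vW v1; split; rewrite ?reflection_mem// /ipnorm reflection_isometry.
have fW : (f @: W <= W)%VS.
  by apply/subvP => _ /memv_imgP[v vW ->]; rewrite reflection_mem.
rewrite /Rintegral; congr fine.
have mEh : measurable_fun setT (EFin \o h : borelV V -> \bar R).
  exact/measurable_EFinP.
have := @integral_pushforward _ _ _ _ R _ (measurable_end f) mu S _ mEh.
rewrite fS => /(_ ihr (measurable_sphere W)) <-.
apply: eq_measure_integral => [|mf A mA _]; first exact: measurable_end.
have iso : {in W &, forall v w, ip (f v) (f w) = ip v w}.
  by move=> v w _ _; exact: reflection_isometry.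
have inv := proj2 mu_sphere f fW iso A mA.
exact: inv.
Qed.

(** The reflection in [u] changes the sign of the integrand, so the integral equals its own
    opposite. *)
Lemma sphere_moment1 u : u \in W -> \int[mu]_(v in S) ip u v = 0.
Proof.
move=> uW; have flip v : ip u (reflection ip u v) = - ip u v.
  by rewrite reflection_adjoint reflection_self -scaleN1r ipZl mulN1r.
have := @sphere_reflection_invariant u (ip u) uW (measurable_ip u).
under eq_Rintegral do rewrite flip -mulN1r.
rewrite RintegralZl; [|exact: measurable_sphere|exact: sphere_integrable_ip].
have : mu.-integrable S (EFin \o (ip u \o reflection ip u)).
  rewrite (_ : _ \o _ = EFin \o ip (- u)); first exact: sphere_integrable_ip.
  by apply/funext => v /=; rewrite flip -[- u]scaleN1r ipZl mulN1r.
by move=> /[swap] /[apply]; lra.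
Qed.

(** The second moment form. Its invariance under reflections in vectors of [W] forces it to be a
    multiple of [ip] on [W]; the following facts establish this. *)
Let Q u w := \int[mu]_(v in S) (ip u v * ip w v).

Let Q_reflection x u w : x \in W ->
  Q (reflection ip x u) (reflection ip x w) = Q u w.
Proof.
move=> xW; rewrite /Q.
have := @sphere_reflection_invariant x (fun v => ip u v * ip w v) xW.
under eq_Rintegral do rewrite !reflection_adjoint.
apply.
- by apply: measurable_funM; exact: measurable_ip.
- rewrite (_ : _ \o _ = EFin \o (fun v =>
    ip (reflection ip x u) v * ip (reflection ip x w) v)).
    exact: sphere_integrable_ipM.
  by apply/funext => v /=; rewrite !reflection_adjoint.
Qed.

Let QC u w : Q u w = Q w u.
Proof. by apply: eq_Rintegral => v _; rewrite mulrC. Qed.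

Let QZ a u w : Q (a *: u) w = a * Q u w.
Proof.
rewrite /Q; under eq_Rintegral do rewrite ipZl -mulrA.
by rewrite RintegralZl//; [exact: measurable_sphere|exact: sphere_integrable_ipM].
Qed.

Let QD u u' w : Q (u + u') w = Q u w + Q u' w.
Proof.
rewrite /Q; under eq_Rintegral do rewrite ipDl mulrDl.
by rewrite RintegralD//; [exact: measurable_sphere|exact: sphere_integrable_ipM
  |exact: sphere_integrable_ipM].
Qed.

(** The reflection in [u] negates [u] and fixes [w]. *)
Let Q_orthogonal u w : u \in W -> ip u w = 0 -> Q u w = 0.
Proof.
move=> uW uw; have := Q_reflection u w uW.
by rewrite reflection_self (reflection_id uw) -scaleN1r QZ; lra.
Qed.

Let Q_sphere u w : u \in W -> w \in W -> ip u u = ip w w -> Q u u = Q w w.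
Proof.
move=> uW wW uw; rewrite -(Q_reflection u u (memvB uW wW)).
by rewrite reflection_swap.
Qed.

(** On the diagonal, [u] is compared with the multiple of [e] of the same norm; off the diagonal,
    [w] is split into a multiple of [u] and a vector orthogonal to [u]. *)
Let Q_unit e u w : e \in W -> ip e e = 1 -> u \in W -> w \in W ->
  Q u w = Q e e * ip u w.
Proof.
move=> eW e1 uW wW.
have [->|u0] := eqVneq u 0.
  by rewrite -(scale0r 0) QZ ipZl !mul0r mulr0.
have uu : 0 < ip u u by exact: ip_gt0.
have QuE : Q u u = Q e e * ip u u.
  have -> : Q u u = Q (Num.sqrt (ip u u) *: e) (Num.sqrt (ip u u) *: e).
    apply: Q_sphere; rewrite ?memvZ//.
    by rewrite ipZl ipZr e1 mulr1 -expr2 sqr_sqrtr// ltW.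
  by rewrite QZ QC QZ mulrA -expr2 sqr_sqrtr ?ltW// mulrC.
pose t := ip u w / ip u u.
have -> : w = t *: u + (w - t *: u) by rewrite addrC subrK.
have uw' : ip u (w - t *: u) = 0.
  by rewrite ipBr ipZr /t divfK ?gt_eqF// subrr.
rewrite QC QD QZ (QC _ u) (Q_orthogonal uW uw') ipDr uw' ipZr QuE; ring.
Qed.

(** The factor [Q e e] is found from the trace: the values [Q f f] over a frame are all equal, there
    are [\dim W] of them, and they sum to the integral of the squared norm, which is 1. *)
Lemma sphere_moment2 u w : u \in W -> w \in W ->
  \int[mu]_(v in S) (ip u v * ip w v) = ip u w / (\dim W)%:R.
Proof.
move=> uW wW; have [s [sz sW s1 sE]] := unit_frame ip W.
have W0 := sphere_dim_gt0.
have [e es] : exists e, e \in s.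
  by case: s sz {sW s1 sE} W0 => [<-//|e s _ _]; exists e; rewrite mem_head.
rewrite -/(Q u w) (Q_unit (sW _ es) (s1 _ es) uW wW).
suff : Q e e * (\dim W)%:R = 1.
  move=> h; have d0 : (\dim W)%:R != 0 :> R by rewrite pnatr_eq0 -lt0n.
  by apply: (mulIf d0); rewrite divfK// mulrAC h mul1r.
have <- : \sum_(f <- s) Q f f = Q e e * (\dim W)%:R.
  have -> : Q e e * (\dim W)%:R = \sum_(f <- s) Q e e.
    by rewrite big_const_seq count_predT iter_addr_0 -sz mulr_natr.
  rewrite !big_seq; apply: eq_bigr => f fs; apply: Q_sphere; rewrite ?sW//.
  by rewrite !s1.
rewrite -[RHS]sphere_integral_cst.
have <- : \int[mu]_(v in S) (\sum_(f <- s) ip f v * ip f v) =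
          \int[mu]_(v in S) 1.
  apply: eq_Rintegral => v; rewrite inE => -[vW /ipnorm1 <-].
  rewrite [in X in ip X _](sE v vW) ip_suml.
  by apply: eq_bigr => f _; rewrite ipZl (ipC _ _ f).
by rewrite sphere_integral_sum// => f; exact: sphere_integrable_ipM.
Qed.

End SphereMeasure.

(** * Orbit designs as moment conditions on group sums *)

Section OrbitDesigns.
Variables (R : realType) (V : vectType R) (ip : {dot V for @idfun R}).
Variables (gT : finGroupType) (rho : gT -> 'End(V)).
Hypothesis rho_orthogonal : orthogonal_action rho ip.
Implicit Types (u v w x : V) (W : {vspace V}) (g h : gT).

Lemma rho1 v : rho 1%g v = v.
Proof. by rewrite (proj1 (proj1 rho_orthogonal)) id_lfunE. Qed.

Lemma rhoM g h v : rho (g * h)%g v = rho g (rho h v).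
Proof. by rewrite (proj2 (proj1 rho_orthogonal)) comp_lfunE. Qed.

Lemma rhoK g v : rho g^-1%g (rho g v) = v.
Proof. by rewrite -rhoM mulVg rho1. Qed.

Lemma rhoVK g v : rho g (rho g^-1%g v) = v.
Proof. by rewrite -rhoM mulgV rho1. Qed.

Lemma rho_ip g u v : ip (rho g u) (rho g v) = ip u v.
Proof. exact: (proj2 rho_orthogonal). Qed.

Lemma rho_adjoint g u v : ip (rho g u) v = ip u (rho g^-1%g v).
Proof. by rewrite -[RHS](rho_ip g) rhoVK. Qed.

Lemma rho_mem W g v : invariant_subspace rho W -> v \in W -> rho g v \in W.
Proof. by move=> /(_ g)/subvP iW vW; apply: iW; rewrite memv_img. Qed.

Lemma card_group_neq0 : #|gT|%:R != 0 :> R.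
Proof. by rewrite pnatr_eq0 -lt0n; apply/card_gt0P; exists 1%g. Qed.

Lemma mem_rep_orbit x g : rho g x \in rep_orbit rho x.
Proof. by apply/imfsetP; exists g. Qed.

(** Double counting of the sum of [f (rho g y)] over all [g] and all orbit points [y] handles
    stabilizers: each [rho g] permutes the orbit, and for fixed [y] right translation in the group
    gives the sum for [x]. *)
Lemma rep_orbit_average (f : V -> R) x :
  (#|` rep_orbit rho x|%:R)^-1 * (\sum_(y <- rep_orbit rho x) f y) =
  (#|gT|%:R)^-1 * \sum_g f (rho g x).
Proof.
set X := rep_orbit rho x.
have X0 : #|` X|%:R != 0 :> R.
  rewrite pnatr_eq0 cardfs_eq0; apply/fset0Pn; exists (rho 1%g x).
  exact: mem_rep_orbit.
have shift g : \sum_(y <- X) f (rho g y) = \sum_(y <- X) f y.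
  rewrite -(big_map (rho g) xpredT f); apply: perm_big; apply: uniq_perm.
  - by rewrite map_inj_uniq ?fset_uniq//; exact: can_inj (rhoK g).
  - exact: fset_uniq.
  move=> y; apply/mapP/idP => [[_ /imfsetP[h _ ->] ->]|/imfsetP[h _ ->]].
    by rewrite -rhoM mem_rep_orbit.
  by exists (rho (g^-1 * h)%g x); [exact: mem_rep_orbit|rewrite -rhoM mulKVg].
have E1 : \sum_g \sum_(y <- X) f (rho g y) = #|gT|%:R * \sum_(y <- X) f y.
  under eq_bigr do rewrite shift.
  by rewrite sumr_const mulr_natl.
have E2 : \sum_g \sum_(y <- X) f (rho g y) = #|` X|%:R * \sum_g f (rho g x).
  rewrite exchange_big/=; transitivity (\sum_(y <- X) \sum_g f (rho g x)).
    rewrite [LHS]big_seq [RHS]big_seq; apply: eq_bigr => _ /imfsetP[h _ ->].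
    by rewrite [RHS](reindex_inj (mulIg h))/=; apply: eq_bigr => g _; rewrite rhoM.
  by rewrite big_const_seq count_predT iter_addr_0 mulr_natl.
have G0 := card_group_neq0.
apply: (mulfI X0); apply: (mulfI G0).
by rewrite mulVKf// [RHS]mulrCA mulVKf// -E1 -E2.
Qed.

(** The constant [a] is left free because the components of a design in the whole space are in
    general not unit vectors: they inherit the constant of [V], not that of their own subspace. *)
Definition isotropic W (a : R) x :=
  {in W, forall u, \sum_g ip u (rho g x) = 0} /\
  {in W &, forall u w,
     \sum_g ip u (rho g x) * ip w (rho g x) = #|gT|%:R * (a * ip u w)}.

(** Summing the second moments over a frame gives the trace; by Parseval and invariance each group
    element contributes [ip x x]. *)
Lemma isotropic_sqnorm W a x : invariant_subspace rho W -> x \in W ->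
  isotropic W a x -> ip x x = a * (\dim W)%:R.
Proof.
move=> iW xW [_ m2]; have [s [sz sW s1 sE]] := unit_frame ip W.
apply: (mulfI card_group_neq0).
have -> : #|gT|%:R * (a * (\dim W)%:R) =
    \sum_(e <- s) \sum_g ip e (rho g x) * ip e (rho g x).
  rewrite big_seq.
  under eq_bigr => e es do rewrite m2 ?sW// s1// mulr1.
  by rewrite -big_seq big_const_seq count_predT iter_addr_0 sz mulr_natr mulrnAr.
rewrite exchange_big/= mulr_natl -sumr_const; apply: eq_bigr => g _.
have gxW := rho_mem g iW xW.
rewrite -(rho_ip g) [in LHS](sE _ gxW) ip_suml.
by apply: eq_bigr => e _; rewrite ipZl (ipC _ _ e) -(sE _ gxW).
Qed.

Lemma orbit_designP W nu x : is_sphere_measure ip W nu ->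
  invariant_subspace rho W -> sphere ip W x ->
  spherical_design ip W nu 2 (rep_orbit rho x) <->
  isotropic W (\dim W)%:R^-1 x.
Proof.
move=> nuW iW [xW x1]; have G0 := card_group_neq0; split.
  case=> _ avg; split=> [u uW|u w uW wW].
    have := avg _ (QuadraticPolynomial.polynomial_function_linear W (ip u)).
    rewrite rep_orbit_average (sphere_moment1 nuW)// => /eqP.
    by rewrite mulf_eq0 invr_eq0 (negPf G0)/= => /eqP.
  have := avg _ (QuadraticPolynomial.polynomial_function_linearM W (ip u) (ip w)).
  rewrite rep_orbit_average (sphere_moment2 nuW)// => h.
  by rewrite [_^-1 * _]mulrC -h mulVKf.
case=> m1 m2; split.
  move=> _ /imfsetP[g _ ->]; split; first exact: rho_mem.
  by rewrite /ipnorm rho_ip.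
move=> f /QuadraticPolynomial.polynomial_function_coord[c [b [a fE]]].
(* Riesz vectors turn the coordinates of [W] into inner products, so that the moment formulas apply
   to [f]. *)
have /choice[u uP] : forall i, exists u,
    u \in W /\ {in W, forall v, coord (vbasis W) i v = ip u v}.
  by move=> i; have [u uW uE] := riesz ip W (coord (vbasis W) i); exists u.
have {}fE : {in W, forall v, f v = c + \sum_i b i * ip (u i) v
    + \sum_i \sum_j a i j * (ip (u i) v * ip (u j) v)}.
  move=> v vW; rewrite fE//; congr (_ + _ + _); apply: eq_bigr => i _.
    by rewrite (proj2 (uP i)).
  by apply: eq_bigr => j _; rewrite (proj2 (uP i))// (proj2 (uP j)).
have iC := sphere_integrable_cst ip W nu c.
have i1 i : nu.-integrable (sphere ip W) (EFin \o (fun v => b i * ip (u i) v)).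
  by apply: sphere_integrableZl; exact: sphere_integrable_ip.
have i2 i j : nu.-integrable (sphere ip W)
    (EFin \o (fun v => a i j * (ip (u i) v * ip (u j) v))).
  by apply: sphere_integrableZl; exact: sphere_integrable_ipM.
have i2' i : nu.-integrable (sphere ip W)
    (EFin \o (fun v => \sum_j a i j * (ip (u i) v * ip (u j) v))).
  exact: sphere_integrable_sum.
have mS := measurable_sphere ip W.
(* The linear part integrates to 0 and the quadratic part is given by the second moments; the group
   average below yields the same value. *)
have -> : \int[nu]_(v in sphere ip W) f v =
    c + \sum_i \sum_j a i j * (ip (u i) (u j) / (\dim W)%:R).
  under eq_Rintegral => v do
    [rewrite inE => -[vW _]; rewrite fE//; over].
  rewrite RintegralD//; last 2 first.
  - by apply: sphere_integrableD => //; exact: sphere_integrable_sum.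
  - exact: sphere_integrable_sum.
  rewrite RintegralD//; last exact: sphere_integrable_sum.
  rewrite (sphere_integral_cst nuW)// !sphere_integral_sum// [X in _ + X + _]big1.
    rewrite addr0; congr (_ + _); apply: eq_bigr => i _.
    rewrite sphere_integral_sum//; apply: eq_bigr => j _.
    rewrite RintegralZl//; last exact: sphere_integrable_ipM.
    by rewrite (sphere_moment2 nuW)//; apply uP.
  move=> i _; rewrite RintegralZl//; last exact: sphere_integrable_ip.
  by rewrite (sphere_moment1 nuW) ?mulr0//; apply uP.
rewrite rep_orbit_average; apply: (mulfI G0); rewrite mulVKf//.
under eq_bigr do rewrite fE ?rho_mem//.
rewrite !big_split/= sumr_const mulrDr.
rewrite exchange_big [X in _ + X + _]big1/= ?addr0; last first.
  by move=> i _; rewrite -mulr_sumr m1 ?mulr0//; apply uP.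
congr (_ + _); first by rewrite mulr_natl.
rewrite exchange_big mulr_sumr/=; apply: eq_bigr => i _.
rewrite exchange_big mulr_sumr/=; apply: eq_bigr => j _.
rewrite -mulr_sumr m2; [|by apply uP|by apply uP].
by rewrite mulrCA [_^-1 * _]mulrC.
Qed.

End OrbitDesigns.

(** * Schur's lemma and vanishing of mixed moments *)

Section Schur.
Variables (R : realType) (V : vectType R) (ip : {dot V for @idfun R}).
Variables (gT : finGroupType) (rho : gT -> 'End(V)).
Hypothesis rho_orthogonal : orthogonal_action rho ip.
Implicit Types (u v w x y : V) (B K U W : {vspace V}) (g h : gT).

Lemma invariant_cap_orthov B K : invariant_subspace rho B ->
  invariant_subspace rho K -> invariant_subspace rho (B :&: orthov ip K)%VS.
Proof.
move=> iB iK g; apply/subvP => _ /memv_imgP[v + ->].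
rewrite !memv_cap => /andP[vB /mem_orthovP vK]; rewrite rho_mem//=.
apply/mem_orthovP => k kK.
have := vK _ (rho_mem (g^-1)%g iK kK).
by move=> h; apply: etrans h; exact: (rho_adjoint rho_orthogonal).
Qed.

Section Intertwiner.
Variable T : 'End(V).
Hypothesis T_rho : forall g v, T (rho g v) = rho g (T v).

Lemma irreducible_img B : irreducible_subrep rho B ->
  (B :&: lker T = 0)%VS -> irreducible_subrep rho (T @: B)%VS.
Proof.
case=> B0 iB minB BT0; split.
- by apply: contra B0; rewrite -lkerE -BT0 => /capv_idPl->.
- move=> g; apply/subvP => _ /memv_imgP[_ /memv_imgP[b bB ->] ->].
  by rewrite -T_rho memv_img// rho_mem.
(* An invariant subspace [C] of the image is the image of its preimage [D] in [B], to which
   minimality of [B] applies. *)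
move=> C CT iC; pose D := (B :&: T @^-1: C)%VS.
have iD : invariant_subspace rho D.
  move=> g; apply/subvP => _ /memv_imgP[v + ->].
  rewrite !memv_cap -!memv_preim => /andP[vB vC].
  by rewrite rho_mem//= T_rho rho_mem.
have CD : C = (T @: D)%VS.
  apply/eqP; rewrite eqEsubv; apply/andP; split; apply/subvP => c.
    move=> cC; have /memv_imgP[b bB cE] := subvP CT _ cC.
    by rewrite cE memv_img// memv_cap bB -memv_preim -cE.
  by case/memv_imgP=> b + ->; rewrite memv_cap -memv_preim => /andP[].
by have [D0|D0] := minB D (capvSl _ _) iD; [left|right]; rewrite CD D0 ?limg0.
Qed.

(** Strong induction on the dimension of an invariant subspace [B] of [W]. If [T] is injective on
    [B], the induction hypothesis leaves no proper nonzero invariant subspace, so a nonzero [B]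
    would be irreducible and isomorphic to its image in [U]. Otherwise [B] splits into the kernel
    and its complement in [B], which is smaller and therefore killed by [T]. *)
Lemma schur U W : invariant_subspace rho W -> (T @: W <= U)%VS ->
  (forall B C, (B <= W)%VS -> (C <= U)%VS -> irreducible_subrep rho B ->
    irreducible_subrep rho C -> ~ isomorphic_subreps rho B C) ->
  {in W, forall w, T w = 0}.
Proof.
move=> iW TU no_common.
suff h n B : (\dim B < n)%N -> (B <= W)%VS -> invariant_subspace rho B ->
    {in B, forall w, T w = 0} by exact: (h _ W (ltnSn _)).
elim: n B => // n IH B dB BW iB w wB.
have IHB C : (C <= B)%VS -> invariant_subspace rho C ->
    C = B \/ {in C, forall w, T w = 0}.
  move=> CB iC; have [->|CneqB] := eqVneq C B; first by left.
  right; apply: IH => //; last exact: subv_trans BW.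
  rewrite -ltnS; apply: leq_trans dB; rewrite ltnS ltn_neqAle dimvS// andbT.
  by apply: contra CneqB => /eqP dE; rewrite eqEdim CB dE leqnn.
pose K := (B :&: lker T)%VS.
have iK : invariant_subspace rho K.
  move=> g; apply/subvP => _ /memv_imgP[v + ->].
  rewrite !memv_cap !memv_ker => /andP[vB /eqP Tv].
  by rewrite rho_mem//= T_rho Tv linear0.
have [K0|K0] := eqVneq K 0%VS.
  have [->|w0] := eqVneq w 0; first by rewrite linear0.
  have irrB : irreducible_subrep rho B.
    split=> // [|C CB iC].
      by apply: contra w0 => /eqP B0; rewrite -memv0 -B0.
    have [->|TC] := IHB C CB iC; [by right|left].
    apply/eqP; rewrite -subv0 -K0 subv_cap CB; apply/subvP => c cC.
    by rewrite memv_ker TC.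
  exfalso; apply: (no_common B (T @: B)%VS) => //.
  - exact: subv_trans (limgS T BW) TU.
  - exact: irreducible_img.
  - by exists T; split=> // g v _; exact: T_rho.
have [BK|TK] := IHB _ (capvSl B (orthov ip K)) (invariant_cap_orthov iB iK).
  (* If the complement were all of [B], then [K] would be orthogonal to itself, hence zero. *)
  case/negP: K0; rewrite -subv0 -(orthov_cap0 ip K) subv_cap subvv/=.
  by rewrite (subv_trans (capvSl _ _))// -BK capvSr.
(* The Riesz vector [k] of [ip w] on [K] is the orthogonal projection of [w] onto [K]. *)
have [k kK kE] := riesz ip K (ip w).
have kBT : k \in B /\ T k = 0.
  by move: kK; rewrite memv_cap memv_ker => /andP[? /eqP].
rewrite -(subrK k w) linearD/= (proj2 kBT) addr0.
apply: TK; rewrite memv_cap memvB ?(proj1 kBT)//=.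
apply/mem_orthovP => v vK.
by have := kE v vK => /eqP; rewrite -subr_eq0 -ipBl => /eqP.
Qed.

End Intertwiner.

(* The sum over [g] of the rank one operators [(g x) (g y)^T]. *)
Definition orbit_tensor_fun x y w := \sum_g ip w (rho g y) *: rho g x.

Fact orbit_tensor_linear x y : linear (orbit_tensor_fun x y).
Proof.
move=> a v w; rewrite /orbit_tensor_fun scaler_sumr -big_split/=.
by apply: eq_bigr => g _; rewrite ipDl ipZl scalerDl scalerA.
Qed.

HB.instance Definition _ x y := GRing.isLinear.Build R V V _
  (orbit_tensor_fun x y) (orbit_tensor_linear x y).

(** Averaging over the group makes the tensor operator [T] an intertwiner, and it sends [W] into
    [U], so it vanishes on [W]; the mixed moment is its entry [ip u (T w)]. *)
Lemma cross_moment0 U W x y :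
  invariant_subspace rho U -> invariant_subspace rho W -> x \in U ->
  (forall B C, (B <= W)%VS -> (C <= U)%VS -> irreducible_subrep rho B ->
    irreducible_subrep rho C -> ~ isomorphic_subreps rho B C) ->
  forall u, {in W, forall w,
    \sum_g ip u (rho g x) * ip w (rho g y) = 0}.
Proof.
move=> iU iW xU no_common u w wW; pose T := linfun (orbit_tensor_fun x y).
have T_rho h v : T (rho h v) = rho h (T v).
  rewrite !lfunE/= /orbit_tensor_fun linear_sum/=.
  rewrite [LHS](reindex_inj (mulgI h))/=; apply: eq_bigr => g _.
  by rewrite linearZ/= !(rhoM rho_orthogonal) (rho_ip rho_orthogonal).
have TU : (T @: W <= U)%VS.
  apply/subvP => _ /memv_imgP[v _ ->]; rewrite lfunE/= /orbit_tensor_fun.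
  by apply: memv_suml => g _; rewrite memvZ// rho_mem.
have : ip u (T w) = 0 by rewrite (schur T_rho iW TU no_common)// linear0r.
rewrite lfunE/= /orbit_tensor_fun ip_sumr => E; rewrite -[RHS]E.
by apply: eq_bigr => g _; rewrite ipZr mulrC.
Qed.

End Schur.

(** * Isotropy of a sum and of its components *)

Section OrthogonalDecomposition.
Variables (R : realType) (V : vectType R) (ip : {dot V for @idfun R}).
Variables (r : nat) (Vs : 'I_r -> {vspace V}).
Hypothesis Vs_orthogonal : forall i j, i != j ->
  {in Vs i & Vs j, forall u v, ip u v = 0}.
Implicit Types (y : 'I_r -> V).

Lemma ip_component i u y : u \in Vs i -> (forall j, y j \in Vs j) ->
  ip u (\sum_j y j) = ip u (y i).
Proof.
move=> uV yV; rewrite ip_sumr (bigD1 i)//= big1 ?addr0// => j ji.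
by rewrite (Vs_orthogonal (i := i) (j := j))// eq_sym.
Qed.

Lemma orthoproj_component i y : (forall j, y j \in Vs j) ->
  orthoproj ip (Vs i) (\sum_j y j) = y i.
Proof.
move=> yV; rewrite (bigD1 i)//= orthoprojE//.
apply: memv_suml => j ji; apply/mem_orthovP => v vV.
exact: (Vs_orthogonal ji).
Qed.

Hypothesis Vs_sum : (\sum_(i < r) Vs i)%VS = fullv.

Lemma component_decomposition v :
  exists2 y, (forall j, y j \in Vs j) & v = \sum_j y j.
Proof.
have /memv_sumP[y yV ->] : v \in (\sum_(i < r) Vs i)%VS by rewrite Vs_sum memvf.
by exists y => // j; exact: yV.
Qed.

Variables (gT : finGroupType) (rho : gT -> 'End(V)).
Hypothesis rho_orthogonal : orthogonal_action rho ip.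
Hypothesis Vs_invariant : forall i, invariant_subspace rho (Vs i).
Hypothesis Vs_no_common_irreducible : forall i j, i != j ->
  forall U W : {vspace V}, (U <= Vs i)%VS -> (W <= Vs j)%VS ->
  irreducible_subrep rho U -> irreducible_subrep rho W ->
  ~ isomorphic_subreps rho U W.

(** A test vector in [Vs i] sees only the component [y i], which gives one direction. Conversely,
    decomposing both test vectors leaves the diagonal terms and the mixed moments, which vanish. *)
Lemma isotropic_sum a y : (forall j, y j \in Vs j) ->
  isotropic ip rho fullv a (\sum_j y j) <->
  forall i, isotropic ip rho (Vs i) a (y i).
Proof.
move=> yV.
have rho_y g : rho g (\sum_j y j) = \sum_j rho g (y j) by rewrite linear_sum.
have gyV g j : rho g (y j) \in Vs j by rewrite rho_mem.
split=> [[m1 m2] i|iso].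
  split=> [u uV|u w uV wV].
    rewrite -[RHS](m1 u (memvf _)); apply: eq_bigr => g _.
    by rewrite rho_y (ip_component uV).
  rewrite -(m2 u w (memvf _) (memvf _)); apply: eq_bigr => g _.
  by rewrite rho_y (ip_component uV)// (ip_component wV).
have expand u g : (forall j, u j \in Vs j) ->
    ip (\sum_i u i) (rho g (\sum_j y j)) = \sum_i ip (u i) (rho g (y i)).
  move=> uV; rewrite rho_y ip_suml; apply: eq_bigr => i _.
  by rewrite (ip_component (uV i)).
split=> [v _|v w _ _].
  have [u uV ->] := component_decomposition v.
  under eq_bigr do rewrite expand//.
  by rewrite exchange_big big1//= => i _; case: (iso i) => ->.
have [u uV ->] := component_decomposition v.
have [z zV ->] := component_decomposition w.
under eq_bigr do rewrite !expand// mulr_suml.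
rewrite exchange_big/= ip_suml !mulr_sumr; apply: eq_bigr => i _.
under eq_bigr do rewrite mulr_sumr.
rewrite (ip_component (uV i))// exchange_big (bigD1 i)//=.
rewrite (proj2 (iso i))// big1 ?addr0// => j ji.
exact: (cross_moment0 rho_orthogonal (y j) (Vs_invariant i) (Vs_invariant j)
  (yV i) (Vs_no_common_irreducible ji) (u i) (zV j)).
Qed.

End OrthogonalDecomposition.

(** * Rescaling of isotropic vectors and the bijection *)

Lemma isotropicZ (R : realType) (V : vectType R) (ip : {dot V for @idfun R})
    (gT : finGroupType) (rho : gT -> 'End(V)) W a c x :
  isotropic ip rho W a x -> isotropic ip rho W (c ^+ 2 * a) (c *: x).
Proof.
case=> m1 m2; split=> [u uW|u w uW wW].
  under eq_bigr do rewrite linearZ ipZr.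
  by rewrite -mulr_sumr m1// mulr0.
under eq_bigr do rewrite linearZ/= !ipZr mulrACA -expr2.
by rewrite -mulr_sumr m2// mulrCA -mulrA.
Qed.

Theorem theorem3p6 (R : realType) (V : vectType R) (ip : {dot V for @idfun R})
    (gT : finGroupType) (rho : gT -> 'End(V))
    (r : nat) (Vs : 'I_r -> {vspace V})
    (mu : probability (borelV V) R)
    (nu : 'I_r -> probability (borelV V) R)
    (rho_orthogonal : orthogonal_action rho ip)
    (Vs_neq0 : forall i, Vs i != 0%VS)
    (Vs_invariant : forall i, invariant_subspace rho (Vs i))
    (Vs_orthogonal : forall i j, i != j ->
       {in Vs i & Vs j, forall u v, ip u v = 0})
    (Vs_sum : (\sum_(i < r) Vs i)%VS = fullv)
    (Vs_no_common_irreducible : forall i j, i != j ->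
       forall U W : {vspace V}, (U <= Vs i)%VS -> (W <= Vs j)%VS ->
       irreducible_subrep rho U -> irreducible_subrep rho W ->
       ~ isomorphic_subreps rho U W)
    (mu_sphere : is_sphere_measure ip {:V} mu)
    (nu_sphere : forall i, is_sphere_measure ip (Vs i) (nu i)) :
  let tuples : set ('I_r -> V) :=
    [set x | forall i, sphere ip (Vs i) (x i) /\
       spherical_design ip (Vs i) (nu i) 2 (rep_orbit rho (x i))] in
  let designs : set V :=
    [set x | sphere ip {:V} x /\
       spherical_design ip {:V} mu 2 (rep_orbit rho x)] in
  set_bij tuples designs (weighted_sum Vs) /\
  (forall x, designs x -> forall i,
     ipnorm ip (orthoproj ip (Vs i) x) ^+ 2 =
       (\dim (Vs i))%:R / (\dim {:V})%:R) /\
  (forall xs x, tuples xs -> designs x -> weighted_sum Vs xs = x -> forall i,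
     xs i = (ipnorm ip (orthoproj ip (Vs i) x))^-1 *: orthoproj ip (Vs i) x).
Proof.
move=> tuples designs.
have iV : invariant_subspace rho fullv by move=> g; exact: subvf.
have d0 i : (\dim (Vs i))%:R != 0 :> R by rewrite pnatr_eq0 dimv_eq0.
(* The existence of [mu] forces [V] to be nonzero, which rules out [r = 0]. *)
have D0 : (\dim {:V})%:R != 0 :> R.
  by rewrite pnatr_eq0 -lt0n (sphere_dim_gt0 mu_sphere).
pose c i : R := Num.sqrt ((\dim (Vs i))%:R / (\dim {:V})%:R).
have c_sqr i : c i ^+ 2 = (\dim (Vs i))%:R / (\dim {:V})%:R.
  by rewrite sqr_sqrtr// divr_ge0.
have c_ge0 i : 0 <= c i by exact: sqrtr_ge0.
have c_neq0 i : c i != 0.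
  by rewrite -sqrf_eq0 c_sqr mulf_neq0// invr_eq0 D0.
have proj_sum xs i : tuples xs ->
    orthoproj ip (Vs i) (weighted_sum Vs xs) = c i *: xs i.
  move=> xsP.
  rewrite (orthoproj_component Vs_orthogonal i (y := fun j => c j *: xs j))//.
  by move=> j; rewrite memvZ//; case: (xsP j) => -[].
have norm_proj xs i : tuples xs -> ipnorm ip (c i *: xs i) = c i.
  move=> xsP; case: (xsP i) => -[_ /ipnorm1 n1] _.
  by rewrite /ipnorm ipZl ipZr n1 mulr1 -expr2 sqrtr_sqr ger0_norm.
(* This inversion formula gives both injectivity and the last claim. *)
have recover xs x : tuples xs -> weighted_sum Vs xs = x -> forall i,
    xs i = (ipnorm ip (orthoproj ip (Vs i) x))^-1 *: orthoproj ip (Vs i) x.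
  by move=> xsP <- i; rewrite proj_sum// norm_proj// scalerA mulVf// scale1r.
(* Shared by surjectivity and the norm formula. *)
have designE x : designs x -> exists y, [/\ forall j, y j \in Vs j,
    x = \sum_j y j, forall i, isotropic ip rho (Vs i) (\dim {:V})%:R^-1 (y i) &
    forall i, ipnorm ip (y i) = c i].
  move=> [xS /(orbit_designP rho_orthogonal mu_sphere iV xS) xiso].
  have [y yV xE] := component_decomposition Vs_sum x.
  have yiso : forall i, isotropic ip rho (Vs i) (\dim {:V})%:R^-1 (y i).
    by apply/(isotropic_sum Vs_orthogonal Vs_sum rho_orthogonal Vs_invariant
      Vs_no_common_irreducible _ yV); rewrite -xE.
  exists y; split=> // i; rewrite /ipnorm.
  by rewrite (isotropic_sqnorm rho_orthogonal (Vs_invariant i) (yV i) (yiso i))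
    mulrC.
split; [split|split].
- move=> xs xsP; pose y i := c i *: xs i.
  have yV j : y j \in Vs j by rewrite memvZ//; case: (xsP j) => -[].
  have iso : isotropic ip rho fullv (\dim {:V})%:R^-1 (weighted_sum Vs xs).
    apply/(isotropic_sum Vs_orthogonal Vs_sum rho_orthogonal Vs_invariant
      Vs_no_common_irreducible _ yV) => i.
    case: (xsP i) => xS.
    move/(orbit_designP rho_orthogonal (nu_sphere i) (Vs_invariant i) xS).
    (* The weights are chosen for this: the square of [c i] divided by [\dim (Vs i)] is the inverse
       of [\dim {:V}], the same for every [i]. *)
    move/(isotropicZ (c i)); rewrite c_sqr.
    by rewrite mulrAC divff// mul1r.
  have S : sphere ip {:V} (weighted_sum Vs xs).
    split; first exact: memvf.
    apply/ipnorm1.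
    by rewrite (isotropic_sqnorm rho_orthogonal iV (memvf _) iso) mulVf.
  split=> //; exact/(orbit_designP rho_orthogonal mu_sphere iV S).
- move=> xs zs; rewrite !inE => xsP zsP E; apply/funext => i.
  by rewrite [RHS](recover _ _ zsP erefl) -E; exact: recover.
- move=> x xP; have [y [yV xE yiso ynorm]] := designE x xP.
  exists (fun i => (c i)^-1 *: y i).
    move=> i; have S : sphere ip (Vs i) ((c i)^-1 *: y i).
      split; first by rewrite memvZ.
      apply/ipnorm1; rewrite ipZl ipZr -ipnorm_sqr ynorm.
      by rewrite expr2 mulKf// mulVf.
    split=> //.
    apply/(orbit_designP rho_orthogonal (nu_sphere i) (Vs_invariant i) S).
    (* Dividing by [c i] restores the constant proper to [Vs i]. *)
    have := isotropicZ (c i)^-1 (yiso i).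
    by rewrite exprVn c_sqr invf_div mulrAC divff ?mul1r ?D0.
  rewrite xE; apply: eq_bigr => i _.
  by rewrite scalerA -/(c i) divff// scale1r.
- move=> x /designE[y [yV -> _ ynorm]] i.
  by rewrite (orthoproj_component Vs_orthogonal)// ynorm.
- by move=> xs x xsP _; exact: recover.
Qed.
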